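(* Let $k$ be a field of characteristic $2$, let $L$ be a Lie algebra over $k$ with $\dim L=2$, and let $r\in L\otimes L$. Then $r$ is a solution of the classical Yang-Baxter equation (CYBE) in $L$ if and only if $r$ is symmetric.
   Context: All tensor products are over $k$. An element $r=\sum_{i,j}k_{ij}(e_i\otimes e_j)\in L\otimes L$ (with $\{e_i\}$ a basis of $L$ and $k_{ij}\in k$) is symmetric if $k_{ij}=k_{ji}$ for all $i,j$. CYBE: for $r=\sum_i a_i\otimes b_i\in L\otimes L$, put $[r^{12},r^{13}]=\sum_{i,j}[a_i,a_j]\otimes b_i\otimes b_j$, $[r^{12},r^{23}]=\sum_{i,j}a_i\otimes[b_i,a_j]\otimes b_j$, $[r^{13},r^{23}]=\sum_{i,j}a_i\otimes a_j\otimes[b_i,b_j]$. Then $r$ is a solution of CYBE in $L$ if $[r^{12},r^{13}]+[r^{12},r^{23}]+[r^{13},r^{23}]=0$.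
   Formalization: The Lie algebra L is additionally assumed non-abelian; for abelian L of dimension 2 every r solves the CYBE, including the non-symmetric e_1⊗e_2, so the claim as stated fails there. *)

(* Defs.v *)
From HB Require Import structures.
From mathcomp Require Import all_boot all_order all_algebra.

Set Implicit Arguments.
Unset Strict Implicit.
Unset Printing Implicit Defensive.

Import GRing.Theory.
Local Open Scope ring_scope.

Reserved Notation "u ⊗ v" (at level 40, left associativity).

HB.mixin Record Vector_isLieAlgebra (k : fieldType) (L : Type)
    of Vector k L := {
  lie : L -> L -> L;
  lie_bilinear : bilinear_for *:%R *:%R lie;
  liexx : forall x, lie x x = 0;
  lie_jacobi : forall x y z,
    lie x (lie y z) + lie y (lie z x) + lie z (lie x y) = 0
}.

#[short(type="lieAlgType")]
HB.structure Definition LieAlgebra (k : fieldType) :=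
  { L of Vector_isLieAlgebra k L & Vector k L }.

(* A tensor of U ⊗ V is encoded by its coordinate matrix in the basis          *)
(* e_i ⊗ f_j, where e and f are the bases chosen by vbasis; tens_lift_tens and *)
(* tens_lift_unique below are the universal property, so that the encoding     *)
(* does not depend on that choice.                                             *)
Definition tensor (k : fieldType) (U V : vectType k) : vectType k :=
  'M[k]_(\dim {:U}, \dim {:V}).

Definition tens (k : fieldType) (U V : vectType k) (u : U) (v : V) :
    tensor U V :=
  \matrix_(i, j) (coord (vbasis {:U}) i u * coord (vbasis {:V}) j v).

Notation "u ⊗ v" := (tens u v) : ring_scope.

Section Tensor.
Variables (k : fieldType) (U V : vectType k).

Lemma tens_bilinear : bilinear_for *:%R *:%R (@tens k U V).
Proof.
split=> [v a u u'|u a v v']; apply/matrixP=> i j; rewrite !mxE linearP.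
  by rewrite mulrDl mulrA.
by rewrite mulrDr mulrCA.
Qed.

HB.instance Definition _ := bilinear_isBilinear.Build k U V (tensor U V)
  *:%R *:%R (@tens k U V) tens_bilinear.

Lemma tensor_delta (r : tensor U V) :
  r = \sum_i \sum_j r i j *: ((vbasis {:U})`_i ⊗ (vbasis {:V})`_j).
Proof.
rewrite {1}[r]matrix_sum_delta; apply: eq_bigr => i _; apply: eq_bigr => j _.
congr (_ *: _); apply/matrixP=> i' j'.
rewrite !mxE !coord_free ?(basis_free (vbasisP _)) // -natrM mulnb.
by rewrite [i' == i]eq_sym [j' == j]eq_sym.
Qed.

Definition tens_lift (W : lmodType k) (f : U -> V -> W) (r : tensor U V) : W :=
  \sum_i \sum_j r i j *: f (vbasis {:U})`_i (vbasis {:V})`_j.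

Lemma tens_lift_linear (W : lmodType k) (f : U -> V -> W) :
  linear (tens_lift f).
Proof.
move=> a r s; rewrite /tens_lift scaler_sumr -big_split; apply: eq_bigr => i _.
rewrite scaler_sumr -big_split; apply: eq_bigr => j _.
by rewrite !mxE scalerDl scalerA.
Qed.

HB.instance Definition _ (W : lmodType k) (f : U -> V -> W) :=
  GRing.isLinear.Build k (tensor U V) W *:%R (tens_lift f)
    (tens_lift_linear f).

Lemma tens_lift_tens (W : lmodType k) (f : {bilinear U -> V -> W}) u v :
  tens_lift f (u ⊗ v) = f u v.
Proof.
rewrite {2}(coord_vbasis (memvf u)) {2}(coord_vbasis (memvf v)) linear_sumlz.
apply: eq_bigr => i _; rewrite linearZl_LR linear_sumr scaler_sumr.
by apply: eq_bigr => j _; rewrite linearZr_LR scalerA mxE.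
Qed.

Lemma tens_lift_unique (W : lmodType k) (g h : {linear tensor U V -> W}) :
  (forall u v, g (u ⊗ v) = h (u ⊗ v)) -> g =1 h.
Proof.
move=> gh r; rewrite (tensor_delta r) !linear_sum; apply: eq_bigr => i _.
by rewrite !linear_sum; apply: eq_bigr => j _; rewrite !linearZ gh.
Qed.

End Tensor.

Section YangBaxter.
Variables (k : fieldType) (L : lieAlgType k).

HB.instance Definition _ :=
  bilinear_isBilinear.Build k L L L *:%R *:%R (@lie k L) (@lie_bilinear k L).

Definition r12_r13 n (a b : 'I_n -> L) : tensor L (tensor L L) :=
  \sum_i \sum_j lie (a i) (a j) ⊗ (b i ⊗ b j).

Definition r12_r23 n (a b : 'I_n -> L) : tensor L (tensor L L) :=
  \sum_i \sum_j a i ⊗ (lie (b i) (a j) ⊗ b j).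

Definition r13_r23 n (a b : 'I_n -> L) : tensor L (tensor L L) :=
  \sum_i \sum_j a i ⊗ (a j ⊗ lie (b i) (b j)).

Definition cybe n (a b : 'I_n -> L) : tensor L (tensor L L) :=
  r12_r13 a b + r12_r23 a b + r13_r23 a b.

(* See cybe_solutionE: the choice of a presentation of r is immaterial. *)
Definition cybe_solution (r : tensor L L) : Prop :=
  forall n (a b : 'I_n -> L), r = \sum_i a i ⊗ b i -> cybe a b = 0.

(* See symmetricE and symmetric_tensorP: the choice of e is immaterial. *)
Definition symmetric_tensor (r : tensor L L) : Prop :=
  forall (e : (\dim {:L}).-tuple L) (K : 'M[k]_(\dim {:L})),
    basis_of {:L} e -> r = \sum_i \sum_j K i j *: (e`_i ⊗ e`_j) ->
    forall i j, K i j = K j i.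

Lemma tensor_presentation (r : tensor L L) :
  exists n (a b : 'I_n -> L), r = \sum_i a i ⊗ b i.
Proof.
exists (\dim {:L}), (fun i => (vbasis {:L})`_i).
exists (fun i => \sum_j r i j *: (vbasis {:L})`_j).
rewrite {1}(tensor_delta r); apply: eq_bigr => i _; rewrite linear_sumr.
by apply: eq_bigr => j _; rewrite linearZr_LR.
Qed.

Lemma basis_presentation (e : (\dim {:L}).-tuple L) (r : tensor L L) :
  basis_of {:L} e -> exists K : 'M[k]_(\dim {:L}),
  r = \sum_i \sum_j K i j *: (e`_i ⊗ e`_j).
Proof.
move=> be; have [n [a [b ->]]] := tensor_presentation r.
exists (\matrix_(i, j) \sum_l coord e i (a l) * coord e j (b l)).
transitivity (\sum_l \sum_i \sum_j
    (coord e i (a l) * coord e j (b l)) *: (e`_i ⊗ e`_j)).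
  apply: eq_bigr => l _.
  rewrite {1}(coord_basis be (memvf (a l))) linear_sumlz; apply: eq_bigr => i _.
  rewrite {1}(coord_basis be (memvf (b l))) linear_sumr; apply: eq_bigr => j _.
  by rewrite linearZl_LR linearZr_LR; exact: scalerA.
rewrite exchange_big; apply: eq_bigr => i _; rewrite exchange_big.
by apply: eq_bigr => j _; rewrite mxE scaler_suml.
Qed.

Lemma presentation_irrel (T : L -> L -> L -> L -> tensor L (tensor L L))
    n m (a b : 'I_n -> L) (c d : 'I_m -> L) :
  (forall c d, bilinear_for *:%R *:%R (fun a b => T a b c d)) ->
  (forall a b, bilinear_for *:%R *:%R (T a b)) ->
  \sum_i a i ⊗ b i = \sum_i c i ⊗ d i ->
  \sum_i \sum_j T (a i) (b i) (a j) (b j) =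
  \sum_i \sum_j T (c i) (d i) (c j) (d j).
Proof.
move=> T12 T34 rE.
have extend f : bilinear_for *:%R *:%R f ->
    \sum_i f (a i) (b i) = \sum_i f (c i) (d i) :> tensor L (tensor L L).
  move=> fb; pose F := bilinear_isBilinear.Build k L L _ *:%R *:%R f fb.
  pose G : {bilinear L -> L -> _} := HB.pack f F.
  have G_tens u v : tens_lift f (u ⊗ v) = f u v := tens_lift_tens G u v.
  have E p (u v : 'I_p -> L) :
      \sum_i f (u i) (v i) = tens_lift f (\sum_i u i ⊗ v i).
    by rewrite linear_sum; apply: eq_bigr => i _; rewrite /= G_tens.
  by rewrite !E rE.
rewrite exchange_big /=.
under eq_bigr => j _ do rewrite (extend _ (T12 (a j) (b j))).
by rewrite exchange_big; apply: eq_bigr => i _; rewrite (extend _ (T34 _ _)).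
Qed.

Lemma cybe_irrel n m (a b : 'I_n -> L) (c d : 'I_m -> L) :
  \sum_i a i ⊗ b i = \sum_i c i ⊗ d i -> cybe a b = cybe c d.
Proof.
move=> rE; rewrite /cybe; congr (_ + _ + _).
- apply: (presentation_irrel (T := fun x y z t => lie x z ⊗ (y ⊗ t))) rE.
    by move=> z t; split=> [v s u u'|u s v v']; rewrite !(linearPl, linearPr).
  by move=> z t; split=> [v s u u'|u s v v']; rewrite !(linearPl, linearPr).
- apply: (presentation_irrel (T := fun x y z t => x ⊗ (lie y z ⊗ t))) rE.
    by move=> z t; split=> [v s u u'|u s v v']; rewrite !(linearPl, linearPr).
  by move=> z t; split=> [v s u u'|u s v v']; rewrite !(linearPl, linearPr).
- apply: (presentation_irrel (T := fun x y z t => x ⊗ (z ⊗ lie y t))) rE.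
    by move=> z t; split=> [v s u u'|u s v v']; rewrite !(linearPl, linearPr).
  by move=> z t; split=> [v s u u'|u s v v']; rewrite !(linearPl, linearPr).
Qed.

Lemma cybe_solutionE n (a b : 'I_n -> L) :
  cybe_solution (\sum_i a i ⊗ b i) <-> cybe a b = 0.
Proof.
split=> [|ab0 m c d /cybe_irrel <- //]; by apply.
Qed.

Lemma symmetric_tensorP (r : tensor L L) :
  symmetric_tensor r <-> r^T = r.
Proof.
have trE e (K : 'M[k]_(\dim {:L})) :
    (\sum_i \sum_j K i j *: (e`_i ⊗ e`_j))^T =
    \sum_i \sum_j K^T i j *: (e`_i ⊗ e`_j) :> tensor L L.
  rewrite [RHS]exchange_big /= [LHS]linear_sum; apply: eq_bigr => i _ /=.
  rewrite linear_sum; apply: eq_bigr => j _ /=; rewrite mxE [LHS]linearZ /=.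
  by congr (_ *: _); apply/matrixP=> x y; rewrite !mxE mulrC.
split=> [/(_ (vbasis {:L}) r (vbasisP _) (tensor_delta r)) rS|rS e K be rE].
  by apply/matrixP=> i j; rewrite mxE.
have cE (M : 'M[k]_(\dim {:L})) i j : M i j =
    tens_lift (fun u v => coord e i u * coord e j v : k^o)
      (\sum_p \sum_q M p q *: (e`_p ⊗ e`_q)).
  have fb : bilinear_for *:%R *:%R
      (fun u v => coord e i u * coord e j v : k^o).
    split=> [v s u u'|u s v v'] /=; rewrite linearP.
      by rewrite mulrDl -mulrA.
    by rewrite mulrDr mulrCA.
  pose F := bilinear_isBilinear.Build k L L k^o *:%R *:%R _ fb.
  pose G : {bilinear L -> L -> k^o} :=
    HB.pack (fun u v => coord e i u * coord e j v : k^o) F.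
  have G_tens u v : tens_lift (fun u v => coord e i u * coord e j v : k^o)
      (u ⊗ v) = coord e i u * coord e j v := tens_lift_tens G u v.
  rewrite linear_sum /= (bigD1 i) //= [X in _ + X]big1 ?addr0 => [|p pi].
    rewrite linear_sum /= (bigD1 j) //= [X in _ + X]big1 ?addr0 => [|q qj].
      rewrite linearZ /= G_tens /= !coord_free ?(basis_free be) //.
      by rewrite !eqxx mulr1 [RHS]mulr1.
    rewrite linearZ /= G_tens /= !coord_free ?(basis_free be) //.
    by rewrite (negPf qj) mulr0 scaler0.
  rewrite linear_sum /= big1 // => q _.
  rewrite linearZ /= G_tens /= !coord_free ?(basis_free be) //.
  by rewrite (negPf pi) mul0r scaler0.
by move=> i j; rewrite [LHS]cE -rE -rS rE trE -cE mxE.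
Qed.

Lemma symmetricE (e : (\dim {:L}).-tuple L) (K : 'M[k]_(\dim {:L})) :
  basis_of {:L} e ->
  symmetric_tensor (\sum_i \sum_j K i j *: (e`_i ⊗ e`_j)) <->
  (forall i j, K i j = K j i).
Proof.
move=> be; split=> [/(_ e K be erefl) //|KS].
apply/symmetric_tensorP; rewrite [LHS]linear_sum /= [RHS]exchange_big /=.
apply: eq_bigr => i _; rewrite linear_sum; apply: eq_bigr => j _ /=.
rewrite [LHS]linearZ /= KS.
by congr (_ *: _); apply/matrixP=> x y; rewrite !mxE mulrC.
Qed.

(* The next two lemmas show that, for an abelian L of dimension 2, being a     *)
(* solution of CYBE is strictly weaker than being symmetric.                   *)
Lemma abelian_cybe_solution (r : tensor L L) :
  (forall x y : L, lie x y = 0) -> cybe_solution r.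
Proof.
move=> ab n a b _; rewrite /cybe /r12_r13 /r12_r23 /r13_r23.
rewrite !big1 ?addr0 // => i _; rewrite big1 // => j _;
  by rewrite ab ?linear0l ?linear0r ?linear0l ?linear0r.
Qed.

Lemma ex_nonsymmetric_tensor :
  \dim {:L} = 2%N -> exists r : tensor L L, ~ symmetric_tensor r.
Proof.
move=> dL; have d0 : (0 < \dim {:L})%N by rewrite dL.
have d1 : (1 < \dim {:L})%N by rewrite dL.
exists (delta_mx (Ordinal d0) (Ordinal d1)) => /symmetric_tensorP/matrixP.
by move=> /(_ (Ordinal d0) (Ordinal d1)) /eqP; rewrite !mxE eq_sym oner_eq0.
Qed.

End YangBaxter.

(* Main.v *)
Require Import Defs.
From HB Require Import structures.
From mathcomp Require Import all_boot all_order all_algebra.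
Import GRing.Theory.
Local Open Scope ring_scope.

(** Let u, v be a basis of L, write w = [u, v] and
      r = u ⊗ p + v ⊗ q,  p = a u + b v,  q = c u + d v.
    Every bracket in L is a multiple of w, and expanding the left-hand side of
    the Yang-Baxter equation in characteristic 2 gives (cybe_pair)
      CYBE(r) = (b + c) (u ⊗ w ⊗ p + v ⊗ w ⊗ q) + (a d + b c) S(w),
    where S(w) is the sum of the six permutations of w ⊗ u ⊗ v. This S is
    linear in w and vanishes at w = u and at w = v, where every term occurs
    twice, so S(w) = 0 (sym3_span). What remains is b + c times the tensor r
    with w inserted in the middle. It vanishes when b = c, that is, when r is
    symmetric. Conversely, if it vanishes, then both (b + c) p and (b + c) q
    are zero, because w is nonzero for a nonabelian L; their coordinates
    (b + c) b and (b + c) c add up to (b + c)^2, whence b = c. *)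

(** * Characteristic 2 *)

Lemma addvv_pchar2 {k : fieldType} {V : lmodType k} (x : V) :
  2%N \in [pchar k] -> x + x = 0.
Proof. by move=> c2; rewrite -mulr2n -scaler_nat pcharf0 // scale0r. Qed.

Lemma addr_eq0_pchar2 {k : fieldType} (x y : k) :
  2%N \in [pchar k] -> x + y = 0 -> x = y.
Proof. by move=> c2 /eqP; rewrite addr_eq0 oppr_pchar2 // => /eqP. Qed.

(** An alternating map is symmetric in characteristic 2, so the coefficient is
    the determinant with a plus sign. This applies to the bracket and, since
    x ⊗ x + x ⊗ x = 0, also to x ⊗ y + y ⊗ x. *)
Lemma alternating_pchar2 {k : fieldType} {U V : lmodType k}
    (f : {bilinear U -> U -> V}) (u v : U) (a b c d : k) :
  2%N \in [pchar k] -> (forall x, f x x = 0) ->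
  f (a *: u + b *: v) (c *: u + d *: v) = (a * d + b * c) *: f u v.
Proof.
move=> c2 f0.
have fC : f v u = f u v.
  have := f0 (u + v); rewrite linearDl !linearDr /= !f0 add0r addr0 => /eqP.
  rewrite addr_eq0 => /eqP ->.
  by rewrite -[RHS]addr0 -(addvv_pchar2 (f v u) c2) addKr.
rewrite linearDl !linearDr /= !linearZl_LR !linearZr_LR /= !f0 !scaler0.
by rewrite add0r addr0 fC !scalerA -scalerDl.
Qed.

(** * Tensors over a span of two vectors *)

(** The antisymmetrization of u ⊗ v ⊗ w, with all signs positive as befits
    characteristic 2. The grouping, by the position of w, is that of the three
    summands of the Yang-Baxter equation. *)
Definition sym3 {k : fieldType} {L : vectType k} (u v w : L) :
    tensor L (tensor L L) :=
  w ⊗ (u ⊗ v + v ⊗ u) + (u ⊗ (w ⊗ v) + v ⊗ (w ⊗ u))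
    + (u ⊗ (v ⊗ w) + v ⊗ (u ⊗ w)).

Lemma sym3C {k : fieldType} {L : vectType k} (u v w : L) :
  sym3 u v w = sym3 v u w.
Proof.
by rewrite /sym3 [u ⊗ v + _]addrC [u ⊗ (w ⊗ v) + _]addrC [u ⊗ (v ⊗ w) + _]addrC.
Qed.

Lemma sym3_linear {k : fieldType} {L : vectType k} (u v : L) :
  linear (sym3 u v).
Proof.
move=> a w w'; rewrite /sym3 !(linearPl, linearPr) /= !scalerDr.
by rewrite [LHS](AC ((2*(2*2))*(2*2))
  (((1*(3*5))*(7*9))*((2*(4*6))*(8*10)))).
Qed.

HB.instance Definition _ (k : fieldType) (L : vectType k) (u v : L) :=
  GRing.isLinear.Build k L (tensor L (tensor L L)) *:%R (sym3 u v)
    (sym3_linear u v).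

Lemma sym3_repeat {k : fieldType} {L : vectType k} (u v : L) :
  2%N \in [pchar k] -> sym3 u v u = 0.
Proof.
move=> c2; rewrite /sym3 linearDr /=.
set A := u ⊗ (u ⊗ v); set B := u ⊗ (v ⊗ u); set C := v ⊗ (u ⊗ u).
by rewrite [LHS](AC (2*2*2) ((1*3)*(2*5)*(4*6))) /= !addvv_pchar2 // !addr0.
Qed.

(** Three vectors of the span of u and v are linearly dependent, so their
    antisymmetrization vanishes; by linearity in the third vector this reduces
    to a repeated vector, for which the six terms cancel in pairs. *)
Lemma sym3_span {k : fieldType} {L : vectType k} (u v : L) (x y : k) :
  2%N \in [pchar k] -> sym3 u v (x *: u + y *: v) = 0.
Proof.
move=> c2; rewrite linearD !linearZ /= sym3_repeat // sym3C sym3_repeat //.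
by rewrite !scaler0 addr0.
Qed.

Lemma tens_eq0 {k : fieldType} {U V : vectType k} (x : U) (y : V) :
  x ⊗ y = 0 -> x != 0 -> y = 0.
Proof.
move=> xy0 x0.
have [i xi] : exists i, coord (vbasis {:U}) i x != 0.
  apply/existsP; apply: contraNT x0 => /existsPn x0.
  rewrite (coord_vbasis (memvf x)) big1 // => i _.
  by have := x0 i; rewrite negbK => /eqP ->; rewrite scale0r.
rewrite (coord_vbasis (memvf y)) big1 // => j _.
have /eqP := congr1 (fun M : 'M_(_, _) => M i j) xy0.
by rewrite !mxE mulf_eq0 (negPf xi) => /eqP ->; rewrite scale0r.
Qed.

Lemma tens_symmetrized_span {k : fieldType} {L : vectType k} (u v : L)
    (a b c d : k) :
  2%N \in [pchar k] ->
  let p := a *: u + b *: v in let q := c *: u + d *: v in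
  p ⊗ q + q ⊗ p = (a * d + b * c) *: (u ⊗ v + v ⊗ u).
Proof.
move=> c2 p q; pose f (x y : L) := x ⊗ y + y ⊗ x.
have fb : bilinear_for *:%R *:%R f.
  by split=> [y s x x'|x s y y'];
    rewrite /f !(linearPl, linearPr) /= scalerDr addrACA.
pose F := bilinear_isBilinear.Build k L L _ *:%R *:%R f fb.
pose G : {bilinear L -> L -> _} := HB.pack f F.
by apply: (alternating_pchar2 G) => // x; exact: addvv_pchar2.
Qed.

Lemma sum_vbasis_tens_eq0 {k : fieldType} {U V : vectType k}
    (y : 'I_(\dim {:U}) -> V) :
  \sum_(l < \dim {:U}) (vbasis {:U})`_l ⊗ y l = 0 -> forall l, y l = 0.
Proof.
move=> y0 l; rewrite (coord_vbasis (memvf (y l))) big1 // => j _.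
have /eqP := congr1 (fun M : 'M_(\dim {:U}, \dim {:V}) => M l j) y0.
rewrite summxE (bigD1 l) //= big1 => [|m ml].
  rewrite !mxE coord_free ?(basis_free (vbasisP _)) // eqxx mul1r addr0.
  by move=> /eqP ->; rewrite scale0r.
by rewrite mxE coord_free ?(basis_free (vbasisP _)) // (negPf ml) mul0r.
Qed.

(** * The Yang-Baxter equation on a two-dimensional Lie algebra *)

(** The middle summand of the Yang-Baxter equation produces b p + a q, where
    p = a u + b v and q = c u + d v; this isolates the multiple of p that must
    vanish, and leaves a determinant for sym3. In coordinates it says that
    b a + a c = (b + c) a and b b + a d = (b + c) b + (a d + b c). *)
Lemma cross_combination {k : fieldType} {V : lmodType k} (u v : V)
    (a b c d : k) :
  2%N \in [pchar k] ->
  b *: (a *: u + b *: v) + a *: (c *: u + d *: v) =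
  (b + c) *: (a *: u + b *: v) + (a * d + b * c) *: v.
Proof.
move=> c2; rewrite !scalerDr !scalerA addrACA -!scalerDl -addrA -scalerDl.
congr (_ *: _ + _ *: _); first by rewrite mulrDl [a * c]mulrC.
by rewrite mulrDl -addrA [a * d + _]addrC [b * c]mulrC addrA addrA addrK_pchar2.
Qed.

(** The first and third summands contribute only to sym3: the first contains
    p ⊗ q + q ⊗ p and the third [p, q] = [q, p], and both expressions are
    alternating in p and q. The obstruction b + c to symmetry comes from the
    middle summand, where p and q appear once in a bracket and once outside. *)
Lemma cybe_pair {k : fieldType} {L : lieAlgType k} (u v : L) (a b c d : k) :
  2%N \in [pchar k] ->
  let p := a *: u + b *: v in let q := c *: u + d *: v in
  let w := lie u v in
  cybe (fun i : 'I_2 => [:: u; v]`_i) (fun i : 'I_2 => [:: p; q]`_i) =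
  (b + c) *: (u ⊗ (w ⊗ p) + v ⊗ (w ⊗ q)) + (a * d + b * c) *: sym3 u v w.
Proof.
move=> c2 p q w.
rewrite /cybe /r12_r13 /r12_r23 /r13_r23 !big_ord_recl !big_ord0 /=.
have lieE x y z t :
    lie (x *: u + y *: v) (z *: u + t *: v) = (x * t + y * z) *: w.
  by apply: alternating_pchar2 => // ?; exact: liexx.
have uE : u = 1 *: u + 0 *: v by rewrite scale1r scale0r addr0.
have vE : v = 0 *: u + 1 *: v by rewrite scale1r scale0r add0r.
have wE : lie v u = w by rewrite {1}vE {2}uE lieE !mul0r !mul1r add0r scale1r.
have pu : lie p u = b *: w by rewrite {1}uE lieE mulr0 mulr1 add0r.
have pv : lie p v = a *: w by rewrite {1}vE lieE mulr0 mulr1 addr0.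
have qu : lie q u = d *: w by rewrite {1}uE lieE mulr0 mulr1 add0r.
have qv : lie q v = c *: w by rewrite {1}vE lieE mulr0 mulr1 addr0.
have pq : lie p q = (a * d + b * c) *: w by exact: lieE.
have qp : lie q p = (a * d + b * c) *: w.
  by rewrite lieE addrC ![c * _]mulrC ![d * _]mulrC.
have lies2 x y z s t :
    x ⊗ ((s *: w) ⊗ y) + x ⊗ ((t *: w) ⊗ z) = x ⊗ (w ⊗ (s *: y + t *: z)).
  by rewrite !linearZl_LR !linearDr !linearZr_LR.
rewrite !liexx pu pv qu qv pq qp wE !(linear0l, linear0r, addr0, add0r) /= -/w.
rewrite -linearDr tens_symmetrized_span // !lies2 cross_combination // -/p.
(* the same identity, after exchanging u with v and p with q *)
have -> : d *: p + c *: q = (b + c) *: q + (a * d + b * c) *: u.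
  rewrite addrC /p /q [a *: u + _]addrC [c *: u + _]addrC.
  rewrite cross_combination //.
  by rewrite [c + b]addrC [d * a]mulrC [c * b]mulrC.
clearbody p q; rewrite /sym3; set s := u ⊗ v + v ⊗ u; clearbody s.
rewrite /= !linearDr /= !linearZr_LR /= !scalerDr.
by rewrite [LHS](AC ((1*(2*2))*2) ((2*4)*((1*(3*5))*(6*7)))).
Qed.

Lemma sum_ord_two {V : nmodType} {n : nat} (n2 : n = 2%N) (F : 'I_n -> V) :
  \sum_i F i = F (cast_ord (esym n2) ord0) + F (cast_ord (esym n2) ord_max).
Proof.
subst n; rewrite !big_ord_recl big_ord0 addr0.
by congr (F _ + F _); apply: val_inj.
Qed.

Theorem proposition2p1 (k : fieldType) (L : lieAlgType k) (r : tensor L L)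
    (char2 : 2%N \in [pchar k]) (dimL : \dim {:L} = 2%N)
    (nonabelian : exists x y : L, lie x y <> 0) :
  cybe_solution r <-> symmetric_tensor r.
Proof.
have sum2 := fun V => @sum_ord_two V _ dimL.
set i0 := cast_ord _ ord0 in sum2; set i1 := cast_ord _ ord_max in sum2.
have i01 : i0 != i1 by rewrite -val_eqE.
have ordP i : i = i0 \/ i = i1.
  have: (i < 2)%N by rewrite -[X in (_ < X)%N]dimL.
  by case E: (nat_of_ord i) => [|[|//]] _; [left | right]; apply: val_inj.
pose e i := (vbasis {:L})`_(i : 'I_(\dim {:L})).
have spanE x :
    x = coord (vbasis {:L}) i0 x *: e i0 + coord (vbasis {:L}) i1 x *: e i1.
  by rewrite {1}(coord_vbasis (memvf x)) sum2.
have eK i j : coord (vbasis {:L}) i (e j) = (j == i)%:R.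
  by rewrite coord_free ?(basis_free (vbasisP _)).
set u := e i0 in spanE eK *; set v := e i1 in spanE *.
(* every bracket is a multiple of that of u and v *)
have w0 : lie u v != 0.
  apply/eqP => w0; case: nonabelian => x [y]; apply.
  rewrite (spanE x) (spanE y) alternating_pchar2 //=; last exact: liexx.
  by rewrite w0 scaler0.
set a := r i0 i0; set b := r i0 i1; set c := r i1 i0; set d := r i1 i1.
pose p := a *: u + b *: v; pose q := c *: u + d *: v.
have rE : r = \sum_(i < 2) [:: u; v]`_i ⊗ [:: p; q]`_i.
  rewrite {1}(tensor_delta r) !big_ord_recl big_ord0 addr0 /= !sum2.
  by rewrite !linearDr /= !linearZr_LR.
have symE : symmetric_tensor r <-> b = c.
  split=> [/symmetric_tensorP/matrixP/(_ i0 i1)|bc].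
    by rewrite mxE.
  apply/symmetric_tensorP/matrixP=> i j; rewrite mxE.
  by case: (ordP i) => ->; case: (ordP j) => ->.
have cybeE := cybe_pair u v a b c d char2; rewrite -/p -/q /= in cybeE.
apply: (iff_trans _ (iff_sym symE)); rewrite {1}rE.
apply: (iff_trans (cybe_solutionE _ _)); rewrite cybeE.
rewrite [X in sym3 _ _ X](spanE (lie u v)) sym3_span // scaler0 addr0.
split=> [|->]; last by rewrite (addrr_pchar2 char2) scale0r.
(* P i0 = p and P i1 = q *)
move=> insert0; pose P l := \sum_m r l m *: e m.
have P0 l : (b + c) *: P l = 0.
  apply: (tens_eq0 (lie u v)) => //; move: l; apply: sum_vbasis_tens_eq0.
  by rewrite sum2 /P !sum2 -/u -/v -/p -/q !linearZr_LR /= -scalerDr.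
have r0 l m : (b + c) * r l m = 0.
  have := congr1 (coord (vbasis {:L}) m) (P0 l).
  rewrite linearZ linear_sum /= (bigD1 m) //= big1 => [|n nm].
    by rewrite linearZ /= eK eqxx linear0 mulr1 addr0.
  by rewrite linearZ /= eK (negPf nm) mulr0.
(* (b + c)^2 is the sum of (b + c) b and (b + c) c *)
apply: addr_eq0_pchar2 => //; apply/eqP; rewrite -[_ == 0]orbb -mulf_eq0.
by rewrite mulrDr !r0 addr0.
Qed.
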